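(* There exist an absolute constant $c>0$ and a function $N(d,\varepsilon)=\tilde\Theta(\sqrt d/\varepsilon)$ such that for every $d\in\mathbb N$, every $\varepsilon\in(0,1]$, every $n\le N(d,\varepsilon)$, and all $\eta\ge1$, $\alpha\in[0,1]$ with $\eta\alpha<1/2$, there is no $(\varepsilon,\delta)$-DP mechanism with $\delta\le c/n$ for $\textsc{1-Way-Marginals}(n,d)$ that is $(\eta,\alpha,1/75)$-accurate. In particular, no such mechanism is $(\eta,\alpha)$-accurate.
   Context: $\textsc{1-Way-Marginals}(n,d)$: on a private $Y\in\{0,1\}^{n\times d}$ output estimates $a_j$ of $\frac1n\sum_iY_{i,j}$, $j\in[d]$; neighboring inputs differ in a single row. A mechanism $\mathcal M$ is $(\varepsilon,\delta)$-DP if $\Pr[\mathcal M(Y)\in S]\le e^\varepsilon\Pr[\mathcal M(Y')\in S]+\delta$ for all neighbors $Y,Y'$ and all $S$. An output is $(\eta,\alpha,\beta)$-accurate for $Y$ if $\frac1\eta\cdot\frac1n\sum_iY_{i,j}-\alpha\le a_j\le\eta\cdot\frac1n\sum_iY_{i,j}+\alpha$ for at least a $(1-\beta)$ fraction of columns $j$; $(\eta,\alpha)$-accurate means $(\eta,\alpha,0)$-accurate. A mechanism is $(\eta,\alpha,\beta)$-accurate if for every $Y$ its output is $(\eta,\alpha,\beta)$-accurate with probability at least $2/3$. $\tilde\Theta$ hides polylogarithmic factors in $d$. *)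

(* Defs.v *)
From HB Require Import structures.
From mathcomp Require Import all_boot all_order all_algebra.
From mathcomp Require Import all_classical all_reals all_analysis.
Set Implicit Arguments. Unset Strict Implicit. Unset Printing Implicit Defensive.
Import Order.TTheory GRing.Theory Num.Theory.
Local Open Scope ring_scope.
Local Open Scope classical_set_scope.

(* A private dataset: an n x d binary matrix Y (rows = individuals). *)
Definition dataset (n d : nat) := 'M[bool]_(n, d).

Definition neighbors n d (Y Y' : dataset n d) : Prop :=
  exists i : 'I_n, forall i' : 'I_n, i' != i -> forall j, Y i' j = Y' i' j.

Definition colmean (R : realType) n d (Y : dataset n d) (j : 'I_d) : R :=
  (\sum_(i < n) ((Y i j : nat)%:R : R)) / n%:R.

Definition accurate_out (R : realType) n d (eta alpha beta : R)
    (Y : dataset n d) (a : d.-tuple R) : Prop :=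
  (1 - beta) * d%:R <=
  #|[set j : 'I_d | (eta^-1 * colmean R Y j - alpha <= tnth a j)
                    && (tnth a j <= eta * colmean R Y j + alpha)]|%:R.

(* A mechanism for 1-Way-Marginals(n,d): to each input, a probability
   distribution on outputs in R^d (Borel product sigma-algebra). *)
Definition mechanism (R : realType) n d :=
  dataset n d -> probability (d.-tuple R) R.

Definition is_DP (R : realType) n d (M : mechanism R n d) (eps delta : R) : Prop :=
  forall Y Y' : dataset n d, neighbors Y Y' ->
  forall S : set (d.-tuple R), measurable S ->
    (M Y S <= (expR eps)%:E * M Y' S + delta%:E)%E.

Definition accurate_mech (R : realType) n d (M : mechanism R n d)
    (eta alpha beta : R) : Prop :=
  forall Y : dataset n d,
    ((2 / 3 : R)%:E <= M Y [set a | accurate_out eta alpha beta Y a])%E.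

(* Main.v *)
(** Thresholding the answers at [alpha] turns the mechanism into one that returns
    a random set [q] of columns which, with probability 2/3, contains almost all
    all-one columns and avoids almost all all-zero columns. Feed it [m] random
    rows whose columns are i.i.d., mostly constant, and exchangeable in the rows.
    A row [i] and a column [x] have a score whose conditional mean given the
    other rows is 0, whose second moment is bounded on average over the rows, and
    such that the scores of all rows add up to [([x = 1] - [x = 0]) / Pr[x]].
    Let [Z_i] be the sum of the scores of row [i] over the columns in [q].
    Accuracy forces [E (sum_i Z_i)] to be of order [d]. By privacy each [E Z_i]
    is close to its value when [q] is computed without row [i], where it has mean 0
    and standard deviation [O(sqrt d)]; so [d <= O(m sqrt d + m delta d)], which
    fails for [m] a small multiple of [sqrt d]. The factor [1/eps] comes from
    repeating each random row about [n/m <= O(1/eps)] times and group privacy. No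
    logarithm is lost, so [N] is of exact order [sqrt d / eps] and [k = 0] works. *)
Require Import Defs.
From HB Require Import structures.
From mathcomp Require Import all_boot all_order all_algebra.
From mathcomp Require Import ring lra zify.
Set Implicit Arguments. Unset Strict Implicit. Unset Printing Implicit Defensive.
Import Order.TTheory GRing.Theory Num.Theory.
Local Open Scope ring_scope.

(** * Privacy inequalities for expectations over a finite set *)

(** The worst event is the set [S] where [Q] exceeds [K * Q']: off [S] the terms of the difference
    are nonpositive, and on [S] the factor [psi] is at most [A]. *)
Lemma dp_sum_nneg (R : realFieldType) (T : finType) (Q Q' psi : T -> R)
    (K delta A : R) :
  (forall S : {set T}, \sum_(t in S) Q t <= K * \sum_(t in S) Q' t + delta) ->
  (forall t, 0 <= psi t <= A) -> 0 <= A ->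
  \sum_t Q t * psi t <= K * (\sum_t Q' t * psi t) + delta * A.
Proof.
move=> dp psiA A0; rewrite -lerBlDl mulr_sumr -sumrB.
pose S := [set t | 0 < Q t - K * Q' t].
apply: (@le_trans _ _ (\sum_(t in S) (Q t - K * Q' t) * A)).
  rewrite [leRHS]big_mkcond /=; apply: ler_sum => t _.
  have /andP[p0 pA] := psiA t; rewrite mulrA -mulrBl inE.
  case: ltrP => h; first by rewrite ler_wpM2l // ltW.
  by rewrite mulr_le0_ge0.
rewrite -mulr_suml ler_wpM2r // sumrB -mulr_sumr lerBlDl.
exact: dp.
Qed.

(** Privacy is applied in one direction to the positive part of [phi] and in the other to the
    negative part. Apart from the [delta] term, the error involves [|phi|] under [Q'] only, which
    will be the law that ignores a row. *)
Lemma dp_sum (R : realFieldType) (T : finType) (Q Q' phi : T -> R)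
    (K delta A : R) :
  1 <= K -> 0 <= delta -> (forall t, 0 <= Q' t) ->
  (forall S : {set T}, \sum_(t in S) Q t <= K * \sum_(t in S) Q' t + delta) ->
  (forall S : {set T}, \sum_(t in S) Q' t <= K * \sum_(t in S) Q t + delta) ->
  (forall t, `|phi t| <= A) -> 0 <= A ->
  \sum_t Q t * phi t <=
    \sum_t Q' t * phi t + (K - 1) * (\sum_t Q' t * `|phi t|) + 2 * (delta * A).
Proof.
move=> K1 d0 Q'0 dp dp' phiA A0.
pose fp t := Num.max (phi t) 0; pose fn t := Num.max (- phi t) 0.
have pA t : - A <= phi t <= A by rewrite -ler_norml.
have fpA t : 0 <= fp t <= A.
  by have /andP[? ?] := pA t; rewrite /fp; case: (leP _ 0) => *; apply/andP; split; lra.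
have fnA t : 0 <= fn t <= A.
  by have /andP[? ?] := pA t; rewrite /fn; case: (leP _ 0) => *; apply/andP; split; lra.
have pE t : phi t = fp t - fn t.
  by rewrite /fp /fn; case: (leP _ 0) => ?; case: (leP _ 0) => ?; lra.
have nE t : `|phi t| = fp t + fn t.
  rewrite /fp /fn; case: (leP 0 (phi t)) => h.
    by rewrite ger0_norm // max_r; lra.
  by rewrite ltr0_norm // max_l; lra.
under eq_bigr do rewrite pE mulrBr.
under [X in _ <= X + _ + _]eq_bigr do rewrite pE mulrBr.
under [X in _ <= _ + _ * X + _]eq_bigr do rewrite nE mulrDr.
rewrite !sumrB big_split /=.
have := dp_sum_nneg dp fpA A0; have := dp_sum_nneg dp' fnA A0.
have b0 : 0 <= \sum_t Q' t * fn t.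
  by apply: sumr_ge0 => t _; rewrite mulr_ge0 //; have /andP[] := fnA t.
have D0 : 0 <= delta * A by rewrite mulr_ge0.
move: (\sum_t Q t * fp t) (\sum_t Q t * fn t) (\sum_t Q' t * fp t)
  (\sum_t Q' t * fn t) (delta * A) b0 D0 => a b a' b' D b0 D0 h1 h2.
(* Times [K] this is at least [(K - 1)^2 * b' + (K - 1) * D], because [b' <= K * b + D]. *)
suff : 0 <= b + (K - 2) * b' + D by lra.
have K0 : 0 < K by lra.
rewrite -(pmulr_rge0 _ K0).
have := mulr_ge0 (sqr_ge0 (K - 1)) b0.
have : 0 <= (K - 1) * D by apply: mulr_ge0; lra.
by rewrite expr2; lra.
Qed.

(** * Product laws, sign-reversing involutions and sums over subsets *)

Lemma sum_prod_marginal (R : comPzSemiRingType) (I T : finType) (P F : T -> R) (j : I) :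
  \sum_t P t = 1 ->
  \sum_(Y : {ffun I -> T}) (\prod_k P (Y k)) * F (Y j) = \sum_t P t * F t.
Proof.
move=> P1; pose G k t := P t * (if k == j then F t else 1).
transitivity (\prod_k \sum_t G k t).
  rewrite bigA_distr_bigA /=; apply: eq_bigr => Y _.
  rewrite big_split /=; congr (_ * _).
  by rewrite -big_mkcond big_pred1_eq.
rewrite (bigD1 j) //= [X in _ * X]big1 => [|k /negPf kj].
  by rewrite mulr1; apply: eq_bigr => t _; rewrite /G eqxx.
by rewrite -[RHS]P1; apply: eq_bigr => t _; rewrite /G kj mulr1.
Qed.

Lemma sum_prod1 (R : comPzSemiRingType) (I T : finType) (P : T -> R) :
  \sum_t P t = 1 -> \sum_(Y : {ffun I -> T}) (\prod_k P (Y k)) = 1.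
Proof.
move=> P1; rewrite -(bigA_distr_bigA (fun=> P)) /=.
by apply: big1 => k _.
Qed.

Lemma sum_involution0 (R : realFieldType) (T : finType) (f : T -> T) (G : T -> R) :
  involutive f -> (forall t, G (f t) = - G t) -> \sum_t G t = 0.
Proof.
move=> fK Gf; have : \sum_t G t = - \sum_t G t.
  rewrite {1}(reindex_inj (inv_inj fK)) /= -sumrN.
  by apply: eq_bigr => t _; rewrite Gf.
by lra.
Qed.

Lemma sum_by_card (R : pzSemiRingType) m (F : nat -> R) :
  \sum_(x : {set 'I_m}) F #|x| = \sum_(w < m.+1) 'C(m, w)%:R * F w.
Proof.
have cm (x : {set 'I_m}) : (#|x| < m.+1)%N by rewrite ltnS -[leqRHS]card_ord max_card.
rewrite (partition_big (fun x => Ordinal (cm x)) xpredT) //=.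
apply: eq_bigr => w _.
rewrite (eq_bigr (fun=> F w)) => [|x /eqP <- //].
rewrite sumr_const mulr_natl; congr (_ *+ _).
have := card_draws 'I_m w; rewrite card_ord => <-; rewrite -cardsE.
by apply: eq_card => x; rewrite !inE.
Qed.

(** A column is encoded as the set of rows in which it is 1; [flip] toggles the entry of one row. *)
Definition flip (T : finType) (i : T) (x : {set T}) : {set T} :=
  if i \in x then x :\ i else i |: x.

Lemma in_flip (T : finType) (i : T) x : (i \in flip i x) = (i \notin x).
Proof. by rewrite /flip; case: ifP; rewrite !inE eqxx. Qed.

Lemma flipK (T : finType) (i : T) : involutive (flip i).
Proof.
move=> x; rewrite {1}/flip in_flip /flip.
by case: (boolP (i \in x)) => ix /=; rewrite ?finset.setD1K ?finset.setU1K.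
Qed.

Lemma flipD1 (T : finType) (i : T) (x : {set T}) : flip i x :\ i = x :\ i.
Proof.
by apply/finset.setP => k; rewrite /flip; case: ifP; rewrite !inE; case: eqP.
Qed.

Lemma sum_if_mem (R : pzRingType) m (x : {set 'I_m}) (a b : R) :
  \sum_i (if i \in x then a else b) = #|x|%:R * a + (m - #|x|)%:R * b.
Proof.
rewrite (bigID (mem x)) /= (eq_bigr (fun=> a)) => [|i ->//].
rewrite [X in _ + X](eq_bigr (fun=> b)) => [|i /negPf ->//].
rewrite !sumr_const !mulr_natl; congr (_ + _ *+ _).
by have := cardC (mem x); rewrite card_ord => e; rewrite -[X in (X - _)%N]e addKn.
Qed.

(** * The law of a random column and the scores of its rows *)

(** At [w = 0] the value is 0, by the convention [0^-1 = 0]. *)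
Definition rsq (R : rcfType) (w : nat) : R := (Num.sqrt w%:R)^-1.

Lemma rsq_ge0 (R : rcfType) w : 0 <= rsq R w.
Proof. by rewrite invr_ge0 sqrtr_ge0. Qed.

Lemma rsq_gt0 (R : rcfType) w : (0 < w)%N -> 0 < rsq R w.
Proof. by move=> w0; rewrite invr_gt0 sqrtr_gt0 ltr0n. Qed.

Lemma sqr_rsq (R : rcfType) w : rsq R w ^+ 2 = w%:R^-1.
Proof. by rewrite exprVn sqr_sqrtr // ler0n. Qed.

(** With [a = sqrt m] and [b = sqrt (m + 1)], the increment satisfies [1 / b <= 2 * (b - a)]: since
    [b^2 = a^2 + 1], this is [(b - a)^2 >= 0]. *)
Lemma sum_rsq_le (R : rcfType) m : \sum_(w < m.+1) rsq R w <= 2 * Num.sqrt m%:R.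
Proof.
elim: m => [|m IH]; first by rewrite big_ord1 /rsq sqrtr0 invr0 mulr0.
rewrite big_ord_recr /=; apply: le_trans (lerD IH (lexx _)) _; rewrite /rsq.
have : Num.sqrt (m.+1%:R : R) ^+ 2 = m.+1%:R by rewrite sqr_sqrtr.
have : Num.sqrt (m%:R : R) ^+ 2 = m%:R by rewrite sqr_sqrtr.
have : 0 < Num.sqrt (m.+1%:R : R) by rewrite sqrtr_gt0.
have : 0 <= Num.sqrt (m%:R : R) by rewrite sqrtr_ge0.
move: (Num.sqrt m%:R) (Num.sqrt m.+1%:R) => a b a0 b0 ea; rewrite -natr1 -ea => eb.
have -> : b^-1 = 1 / b by rewrite div1r.
rewrite -lerBrDl ler_pdivrMr //; have := sqr_ge0 (b - a).
by rewrite !expr2 in eb *; lra.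
Qed.

(* Unnormalised law of the weight of a random column. The two constant columns
   get at least 9/10 of the mass; on the other weights the profile
   [w^(-1/2) + (m-w)^(-1/2)] makes [flux^2 / colpr], summed over all rows and
   columns, linear in [m] without a logarithmic factor. *)
Definition wt (R : rcfType) m w : R :=
  rsq R w + rsq R (m - w) + 18 * Num.sqrt m%:R *+ ((w == 0) || (w == m))%N.

Definition tot (R : rcfType) m : R := \sum_(w < m.+1) wt R m w.

Definition colpr (R : rcfType) m (x : {set 'I_m}) : R :=
  wt R m #|x| / (tot R m * 'C(m, #|x|)%:R).

(* [colpr] times the score of row [i]: the antisymmetry [flux_flip] says that the
   score has conditional mean 0 given the other rows, while [sum_flux] says that
   the scores of all rows cancel except on the two constant columns. *)
Definition flux (R : rcfType) m (i : 'I_m) (x : {set 'I_m}) : R :=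
  if i \in x then (#|x|%:R * 'C(m, #|x|)%:R)^-1
  else - ((m - #|x|)%:R * 'C(m, #|x|)%:R)^-1.

Lemma wt_ge (R : rcfType) m w : rsq R w + rsq R (m - w) <= wt R m w.
Proof. by rewrite lerDl mulrn_wge0 // mulr_ge0 // sqrtr_ge0. Qed.

Lemma wt_gt0 (R : rcfType) m w : (0 < m)%N -> 0 < wt R m w.
Proof.
move=> m0; apply: lt_le_trans (wt_ge R m w).
case: w => [|w]; first by rewrite subn0 ltr_wpDl ?rsq_ge0 ?rsq_gt0.
by rewrite ltr_wpDr ?rsq_ge0 ?rsq_gt0.
Qed.

Lemma sum_rsq_sym_le (R : rcfType) m :
  \sum_(w < m.+1) (rsq R w + rsq R (m - w)) <= 4 * Num.sqrt m%:R.
Proof.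
rewrite big_split /= [X in _ + X](reindex_inj rev_ord_inj) /=.
rewrite [X in _ + X](eq_bigr (fun w : 'I_m.+1 => rsq R w)) => [|w _].
  by have := sum_rsq_le R m; lra.
by rewrite subSS subKn // -ltnS.
Qed.

(** The profile gives at most [4 * sqrt m], the two constant weights at most [18 * sqrt m] each. *)
Lemma tot_le (R : rcfType) m : tot R m <= 40 * Num.sqrt m%:R.
Proof.
rewrite /tot big_split /=.
have := sum_rsq_sym_le R m; suff : \sum_(w < m.+1)
  18 * Num.sqrt (m%:R : R) *+ ((w == 0 :> nat) || (w == m :> nat))%N
   <= 36 * Num.sqrt m%:R by lra.
rewrite sumrMnr.
have s0 : 0 <= Num.sqrt (m%:R : R) by rewrite sqrtr_ge0.
apply: (@le_trans _ _ (18 * Num.sqrt (m%:R : R) *+ 2)); last by rewrite mulr2n; lra.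
apply: ler_wpMn2l; first by rewrite mulr_ge0.
apply: (@leq_trans (\sum_(w < m.+1) ((w == ord0) + (w == ord_max)))).
  by apply: leq_sum => w _; rewrite -!val_eqE /=; do 2!case: eqP.
by rewrite big_split /= -!big_mkcond /= !big_pred1_eq.
Qed.

Lemma tot_gt0 (R : rcfType) m : (0 < m)%N -> 0 < tot R m.
Proof.
move=> m0; rewrite /tot big_ord_recl ltr_wpDr ?wt_gt0 //.
by apply: sumr_ge0 => w _; rewrite ltW ?wt_gt0.
Qed.

Lemma card_ord_set m (x : {set 'I_m}) : (#|x| <= m)%N.
Proof. by rewrite -[leqRHS]card_ord max_card. Qed.

Lemma colpr_gt0 (R : rcfType) m (x : {set 'I_m}) : (0 < m)%N -> 0 < colpr R x.
Proof.
move=> m0; rewrite divr_gt0 ?wt_gt0 // mulr_gt0 ?tot_gt0 //.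
by rewrite ltr0n bin_gt0 card_ord_set.
Qed.

Lemma sum_colpr (R : rcfType) m : (0 < m)%N -> \sum_(x : {set 'I_m}) colpr R x = 1.
Proof.
move=> m0; rewrite (sum_by_card m (fun w => wt R m w / (tot R m * 'C(m, w)%:R))).
rewrite (eq_bigr (fun w : 'I_m.+1 => wt R m w / tot R m)) => [|w _].
  by rewrite -mulr_suml divff // gt_eqF ?tot_gt0.
have : 'C(m, w)%:R != 0 :> R by rewrite pnatr_eq0 -lt0n bin_gt0 -ltnS.
by have := tot_gt0 R m0 => /lt0r_neq0 T0 C0; field; apply/andP.
Qed.

Lemma colpr_set0 (R : rcfType) m : colpr R (@set0 'I_m) = wt R m 0 / tot R m.
Proof. by rewrite /colpr cards0 bin0 mulr1. Qed.

Lemma colpr_setT (R : rcfType) m : colpr R [set: 'I_m] = wt R m 0 / tot R m.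
Proof.
rewrite /colpr cardsT card_ord binn mulr1; congr (_ / _).
by rewrite /wt subn0 subnn !eqxx orbT [_ + rsq R m]addrC.
Qed.

Lemma const_colpr_ge (R : rcfType) m : (0 < m)%N -> 9 / 20 <= wt R m 0 / tot R m.
Proof.
move=> m0; rewrite ler_pdivlMr ?tot_gt0 //.
have := tot_le R m; rewrite /wt eqxx /= mulr1n.
by have := rsq_ge0 R 0; have := rsq_ge0 R (m - 0); lra.
Qed.

(** For [i] outside [x] and [w = #|x|] this is the identity [(w + 1) * C(m, w + 1) = (m - w) * C(m,
    w)]. *)
Lemma flux_flip (R : rcfType) m (i : 'I_m) x : flux R i (flip i x) = - flux R i x.
Proof.
wlog ix : x / i \notin x => [H|].
  case: (boolP (i \in x)) => [ix|]; last exact: H.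
  by rewrite -[x in RHS](flipK i) (H (flip i x)) ?opprK ?in_flip ?ix.
rewrite /flux in_flip ix (negPf ix) /flip (negPf ix) cardsU1 ix /= opprK.
have xm : (#|x| < m)%N.
  by rewrite -[ltnRHS]card_ord -cardsT proper_card // properT; apply: contraNneq ix => ->; rewrite inE.
by rewrite -!natrM add1n mulnC -mul_bin_left mulnC.
Qed.

(** The rows in [x] contribute [1 / C(m, w)] in total and the others [- 1 / C(m, w)]; these cancel
    unless one of the two groups is empty. *)
Lemma sum_flux (R : rcfType) m (x : {set 'I_m}) : (0 < m)%N ->
  \sum_i flux R i x = (x == setT)%:R - (x == set0)%:R.
Proof.
move=> m0; rewrite /flux sum_if_mem.
have -> : (x == setT) = (#|x| == m).
  by rewrite eqEcard finset.subsetT cardsT card_ord /= eqn_leq card_ord_set.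
rewrite -cards_eq0.
have : (#|x| <= m)%N by exact: card_ord_set.
move: #|x| => w wm.
have C0 : 'C(m, w)%:R != 0 :> R by rewrite pnatr_eq0 -lt0n bin_gt0.
have [->|w0] := eqVneq w 0%N.
  by rewrite bin0 !mulr1 subn0 eq_sym gtn_eqF // mul0r mulrN divff
    ?pnatr_eq0 -?lt0n // add0r sub0r.
have w0' : w%:R != 0 :> R by rewrite pnatr_eq0.
have [->|wm'] := eqVneq w m.
  rewrite binn !mulr1 subnn mul0r divff ?pnatr_eq0 -?lt0n //.
  by rewrite ?addr0 ?subr0 //.
have : (m - w)%:R != 0 :> R by rewrite pnatr_eq0 subn_eq0 -ltnNge ltn_neqAle wm'.
by move=> ?; field; apply/and3P.
Qed.

(** Each of the [m + 1] weights contributes at most 2, and [2 * (m + 1) <= 4 * m]. *)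
Lemma sum_abs_flux_le (R : rcfType) m : (0 < m)%N ->
  \sum_(i < m) \sum_x `|flux R i x| <= 4 * m%:R.
Proof.
move=> m0; rewrite exchange_big /=.
pose F w : R := w%:R * (w%:R * 'C(m, w)%:R)^-1 + (m - w)%:R * ((m - w)%:R * 'C(m, w)%:R)^-1.
rewrite (eq_bigr (fun x : {set 'I_m} => F #|x|)) => [|x _]; last first.
  rewrite /F -sum_if_mem; apply: eq_bigr => i _; rewrite /flux.
  by case: ifP => _; rewrite ?normrN ger0_norm // invr_ge0 mulr_ge0.
rewrite sum_by_card; apply: (@le_trans _ _ (\sum_(w < m.+1) 2)).
  apply: ler_sum => w _; rewrite /F.
  have C0 : 'C(m, w)%:R != 0 :> R by rewrite pnatr_eq0 -lt0n bin_gt0 -ltnS.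
  have aux (u : R) : 'C(m, w)%:R * (u * (u * 'C(m, w)%:R)^-1) <= 1.
    have [->|u0] := eqVneq u 0; first by rewrite mul0r mulr0.
    by rewrite le_eqVlt; apply/orP; left; apply/eqP; field; apply/andP.
  by rewrite mulrDr; have := aux w%:R; have := aux (m - w)%:R; lra.
rewrite sumr_const card_ord -mulr_natl -natr1.
have : 1 <= m%:R :> R by rewrite ler1n.
by lra.
Qed.

(** With [a = rsq w] and [b = rsq (m - w)], weight [w] contributes [tot * (a^2 + b^2) / wt], which
    is at most [tot * (a + b)] because [a + b <= wt]. The sum over [w] is at most
    [40 * sqrt m * 4 * sqrt m]. *)
Lemma sum_sqr_flux_le (R : rcfType) m : (0 < m)%N ->
  \sum_(i < m) \sum_x flux R i x ^+ 2 / colpr R x <= 160 * m%:R.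
Proof.
move=> m0; rewrite exchange_big /=.
pose F w : R := (w%:R * (w%:R * 'C(m, w)%:R)^-1 ^+ 2 + 
  (m - w)%:R * ((m - w)%:R * 'C(m, w)%:R)^-1 ^+ 2) / (wt R m w / (tot R m * 'C(m, w)%:R)).
rewrite (eq_bigr (fun x : {set 'I_m} => F #|x|)) => [|x _]; last first.
  rewrite /F -sum_if_mem mulr_suml; apply: eq_bigr => i _; rewrite /flux.
  by case: ifP => _; rewrite ?sqrrN.
rewrite sum_by_card.
apply: (@le_trans _ _ (\sum_(w < m.+1) tot R m * (rsq R w + rsq R (m - w)))).
  apply: ler_sum => w _; rewrite /F.
  have C0 : 'C(m, w)%:R != 0 :> R by rewrite pnatr_eq0 -lt0n bin_gt0 -ltnS.
  have aux (u : R) : u * (u * 'C(m, w)%:R)^-1 ^+ 2 = u^-1 / 'C(m, w)%:R ^+ 2.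
    have [->|u0] := eqVneq u 0; first by rewrite invr0 !mul0r.
    by field; apply/andP.
  rewrite !aux -!sqr_rsq -mulrDl.
  have T0 := tot_gt0 R m0; have W0 := wt_gt0 R w m0.
  have := wt_ge R m w; have := rsq_ge0 R w; have := rsq_ge0 R (m - w).
  move: (rsq R w) (rsq R (m - w)) (wt R m w) (tot R m) W0 T0 => a b W T W0 T0 b0 a0 abW.
  have -> : 'C(m, w)%:R * ((a ^+ 2 + b ^+ 2) / 'C(m, w)%:R ^+ 2 / (W / (T * 'C(m, w)%:R)))
    = T * ((a ^+ 2 + b ^+ 2) / W) by field; rewrite C0 !gt_eqF.
  rewrite ler_wpM2l ?(ltW T0) // ler_pdivrMr //.
  have : (a + b) * (a + b) <= (a + b) * W by rewrite ler_wpM2l // addr_ge0.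
  by have := mulr_ge0 a0 b0; rewrite !expr2; lra.
rewrite -mulr_sumr.
apply: le_trans (ler_wpM2l (ltW (tot_gt0 R m0)) (sum_rsq_sym_le R m)) _.
have s0 : 0 <= Num.sqrt (m%:R : R) by rewrite sqrtr_ge0.
apply: le_trans (ler_wpM2r _ (tot_le R m)) _; first by rewrite mulr_ge0.
have : Num.sqrt (m%:R : R) ^+ 2 = m%:R by rewrite sqr_sqrtr.
by rewrite expr2 => {3}<-; lra.
Qed.

(** * The fingerprinting argument for independent random columns *)

Definition columns m d := {ffun 'I_d -> {set 'I_m}}.

Definition colsw (R : rcfType) m d (Y : columns m d) : R := \prod_k colpr R (Y k).

Definition score (R : rcfType) m (i : 'I_m) (x : {set 'I_m}) : R :=
  flux R i x / colpr R x.

Definition trace_score (R : rcfType) m d (i : 'I_m) (Y : columns m d) (q : {set 'I_d}) : R :=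
  \sum_j (j \in q)%:R * score R i (Y j).

(* Row [i] is set to 0 rather than deleted, which keeps the format of the data
   and yields a data set that does not depend on row [i]. *)
Definition drop_row m d (i : 'I_m) (Y : columns m d) : columns m d :=
  [ffun j => Y j :\ i].

Definition flip_at m d (i : 'I_m) (j : 'I_d) (Y : columns m d) : columns m d :=
  [ffun k => if k == j then flip i (Y k) else Y k].

(** Only constant columns are tested; on the others either answer is admissible. *)
Definition mistakes m d (Y : columns m d) (q : {set 'I_d}) : {set 'I_d} :=
  [set j | ((Y j == setT) && (j \notin q)) || ((Y j == set0) && (j \in q))].

Lemma colsw_gt0 (R : rcfType) m d (Y : columns m d) : (0 < m)%N -> 0 < colsw R Y.
Proof. by move=> m0; apply: prodr_gt0 => k _; exact: colpr_gt0. Qed.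

Lemma colsw_ge0 (R : rcfType) m d (Y : columns m d) : (0 < m)%N -> 0 <= colsw R Y.
Proof. by move=> m0; rewrite ltW ?colsw_gt0. Qed.

Lemma sum_colsw (R : rcfType) m d : (0 < m)%N -> \sum_(Y : columns m d) colsw R Y = 1.
Proof. by move=> m0; apply: sum_prod1; exact: sum_colpr. Qed.

Lemma sum_colsw_marginal (R : rcfType) m d (F : {set 'I_m} -> R) (j : 'I_d) :
  (0 < m)%N -> \sum_(Y : columns m d) colsw R Y * F (Y j) = \sum_x colpr R x * F x.
Proof. by move=> m0; apply: sum_prod_marginal; exact: sum_colpr. Qed.

Lemma colpr_score (R : rcfType) m (i : 'I_m) x : (0 < m)%N ->
  colpr R x * score R i x = flux R i x.
Proof. by move=> m0; rewrite mulrC divfK // gt_eqF ?colpr_gt0. Qed.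

Lemma flip_atK m d (i : 'I_m) (j : 'I_d) : involutive (flip_at i j).
Proof.
by move=> Y; apply/ffunP => k; rewrite !ffunE; case: eqP => // _; rewrite flipK.
Qed.

Lemma drop_row_flip_at m d (i : 'I_m) (j : 'I_d) Y :
  drop_row i (flip_at i j Y) = drop_row i Y.
Proof. by apply/ffunP => k; rewrite !ffunE; case: eqP => // _; rewrite flipD1. Qed.

(** Flipping entry [(i, j)] keeps [H] and negates probability times score, so the terms cancel in
    pairs. *)
Lemma sum_score_indep (R : rcfType) m d (i : 'I_m) (j : 'I_d) (H : columns m d -> R) :
  (0 < m)%N -> (forall Y, H (flip_at i j Y) = H Y) ->
  \sum_Y colsw R Y * (H Y * score R i (Y j)) = 0.
Proof.
move=> m0 Hf; apply: (sum_involution0 (@flip_atK m d i j)) => Y.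
rewrite Hf /colsw (bigD1 j) //= [in RHS](bigD1 j) //= !ffunE eqxx.
rewrite (eq_bigr (fun k => colpr R (Y k))) => [|k /negPf kj]; last by rewrite ffunE kj.
have := flux_flip R i (Y j); rewrite -!colpr_score // => h.
set p := \prod_(_ | _) _; move: h.
move: p (H Y) (colpr _ _) (score _ _ _) (colpr _ (flip _ _)) (score _ _ (flip _ _)).
move=> p u c e a b h; transitivity (u * p * (a * b)); [ring|rewrite h; ring].
Qed.

Lemma sum_score (R : rcfType) m (x : {set 'I_m}) : (0 < m)%N ->
  \sum_i score R i x = ((x == setT)%:R - (x == set0)%:R) / (wt R m 0 / tot R m).
Proof.
move=> m0; rewrite -mulr_suml sum_flux //.
have [->|_] := eqVneq x setT; first by rewrite colpr_setT.
have [->|_] := eqVneq x set0; first by rewrite colpr_set0.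
by rewrite subrr !mul0r.
Qed.

(** Only constant columns survive: an all-one column counts 1 unless it is a mistake, and a mistaken
    all-zero column counts -1. *)
Lemma sum_trace_score (R : rcfType) m d (Y : columns m d) q : (0 < m)%N ->
  \sum_i trace_score R i Y q =
  (#|[set j | Y j == setT]|%:R - #|mistakes Y q|%:R) / (wt R m 0 / tot R m).
Proof.
move=> m0; rewrite exchange_big /= -!sum1_card !natr_sum.
rewrite [X in (X - _) / _]big_mkcond [X in (_ - X) / _]big_mkcond /= -sumrB mulr_suml.
apply: eq_bigr => j _; rewrite -mulr_sumr sum_score // mulrA; congr (_ / _).
rewrite !inE; have T0 : (setT == set0 :> {set 'I_m}) = false.
  by apply/negbTE; rewrite -card_gt0 cardsT card_ord.
have [->|_] := eqVneq (Y j) setT; rewrite ?T0 /=; case: (j \in q) => /=;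
  rewrite ?mul0r ?mul1r ?subrr ?subr0 //.
- by case: (Y j == set0).
- by rewrite andbF subrr.
Qed.

Lemma sum_trace_score_drop_row (R : rcfType) m d (i : 'I_m)
    (Q : columns m d -> {set 'I_d} -> R) : (0 < m)%N ->
  \sum_Y colsw R Y * (\sum_q Q (drop_row i Y) q * trace_score R i Y q) = 0.
Proof.
move=> m0; under eq_bigr do rewrite mulr_sumr.
rewrite exchange_big big1 //= => q _.
under eq_bigr do rewrite !mulr_sumr.
rewrite exchange_big big1 //= => j _.
under eq_bigr do rewrite [Q _ _ * _]mulrA.
apply: (sum_score_indep (j := j) (H := fun Y => Q (drop_row i Y) q * (j \in q)%:R)) => //.
by move=> Y; rewrite drop_row_flip_at.
Qed.

Lemma sum_sqr_trace_score_drop_row (R : rcfType) m d (i : 'I_m)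
    (Q : columns m d -> {set 'I_d} -> R) : (0 < m)%N ->
  (forall Y q, 0 <= Q Y q) -> (forall Y, \sum_q Q Y q = 1) ->
  \sum_Y colsw R Y * (\sum_q Q (drop_row i Y) q * trace_score R i Y q ^+ 2)
    <= d%:R * \sum_x flux R i x ^+ 2 / colpr R x.
Proof.
move=> m0 Q0 Q1.
pose D := \sum_(Y : columns m d) \sum_q \sum_(j < d)
  colsw R Y * (Q (drop_row i Y) q * ((j \in q)%:R * score R i (Y j) ^+ 2)).
have -> : \sum_Y colsw R Y * (\sum_q Q (drop_row i Y) q * trace_score R i Y q ^+ 2) = D.
  under eq_bigr do rewrite mulr_sumr.
  rewrite /D exchange_big [RHS]exchange_big /=; apply: eq_bigr => q _.
  transitivity (\sum_Y \sum_(j < d) \sum_(k < d) colsw R Y *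
    ((Q (drop_row i Y) q * ((j \in q)%:R * (k \in q)%:R) * score R i (Y k)) *
     score R i (Y j))).
    apply: eq_bigr => Y _; rewrite expr2 mulr_suml !mulr_sumr.
    apply: eq_bigr => j _; rewrite !mulr_sumr; apply: eq_bigr => k _; ring.
  rewrite exchange_big [RHS]exchange_big /=; apply: eq_bigr => j _.
  (* The cross terms [k != j] vanish: neither the score of column [k] nor the law of [q] changes
     when entry [(i, j)] is flipped. *)
  rewrite exchange_big (bigD1 j) //= [X in _ + X]big1 ?addr0 => [|k kj].
    apply: eq_bigr => Y _; case: (j \in q) => /=; rewrite ?mulr1n ?mulr0n; ring.
  apply: (sum_score_indep (j := j)) => // Y.
  by rewrite drop_row_flip_at ffunE (negPf kj).
apply: (@le_trans _ _ (\sum_(Y : columns m d) \sum_(j < d) colsw R Y * score R i (Y j) ^+ 2)).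
  rewrite /D; apply: ler_sum => Y _; rewrite exchange_big; apply: ler_sum => j _ /=.
  rewrite -mulr_sumr ler_wpM2l ?colsw_ge0 //.
  apply: (@le_trans _ _ (\sum_q Q (drop_row i Y) q * score R i (Y j) ^+ 2)).
    apply: ler_sum => q _; rewrite ler_wpM2l // ler_piMl ?sqr_ge0 //.
    by case: (_ \in _); rewrite ?lexx ?ler01.
  by rewrite -mulr_suml Q1 mul1r.
rewrite exchange_big /=.
rewrite (eq_bigr (fun=> \sum_x flux R i x ^+ 2 / colpr R x)) => [|j _].
  by rewrite sumr_const card_ord mulr_natl.
rewrite (sum_colsw_marginal (fun x => score R i x ^+ 2)) //.
apply: eq_bigr => x _; rewrite /score.
have : colpr R x != 0 by rewrite gt_eqF ?colpr_gt0.
by move=> ?; field.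
Qed.

(** AM-GM replaces Cauchy-Schwarz: the bound is then linear in the second moment, which is
    controlled only after summing over the rows. *)
Lemma sum_abs_trace_score_drop_row (R : rcfType) m d (i : 'I_m)
    (Q : columns m d -> {set 'I_d} -> R) (tau : R) : (0 < m)%N -> 0 < tau ->
  (forall Y q, 0 <= Q Y q) -> (forall Y, \sum_q Q Y q = 1) ->
  \sum_Y colsw R Y * (\sum_q Q (drop_row i Y) q * `|trace_score R i Y q|)
    <= d%:R * (\sum_x flux R i x ^+ 2 / colpr R x) / (2 * tau) + tau / 2.
Proof.
move=> m0 t0 Q0 Q1.
have amgm (z : R) : `|z| <= z ^+ 2 / (2 * tau) + tau / 2.
  have -> : z ^+ 2 / (2 * tau) + tau / 2 = (`|z| ^+ 2 + tau ^+ 2) / (2 * tau).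
    by rewrite real_normK ?num_real //; field; lra.
  rewrite ler_pdivlMr; last lra.
  by have := sqr_ge0 (`|z| - tau); rewrite !expr2; lra.
pose V := \sum_Y colsw R Y * (\sum_q Q (drop_row i Y) q * trace_score R i Y q ^+ 2).
apply: (@le_trans _ _ (V / (2 * tau) + tau / 2)).
  have -> : V / (2 * tau) + tau / 2 = \sum_Y colsw R Y *
      (\sum_q Q (drop_row i Y) q * (trace_score R i Y q ^+ 2 / (2 * tau) + tau / 2)).
    transitivity (\sum_Y (colsw R Y * (\sum_q Q (drop_row i Y) q * trace_score R i Y q ^+ 2)
       / (2 * tau) + colsw R Y * (tau / 2))).
      by rewrite big_split /= -!mulr_suml sum_colsw // mul1r.
    apply: eq_bigr => Y _; under [in RHS]eq_bigr do rewrite mulrDr mulrA.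
    by rewrite big_split /= -!mulr_suml Q1; ring.
  apply: ler_sum => Y _; rewrite ler_wpM2l ?colsw_ge0 //.
  by apply: ler_sum => q _; rewrite ler_wpM2l.
rewrite lerD2r ler_wpM2r ?invr_ge0 //; first lra.
exact: sum_sqr_trace_score_drop_row.
Qed.

(* 26/75 = 1/75 + 1/3 bounds the expected fraction of mistakes, and 20/9 is the
   inverse of the lower bound 9/20 on the probability of a constant column;
   [tau] is the free parameter of AM-GM. *)
Lemma fingerprinting_bound (R : rcfType) m d (Q : columns m d -> {set 'I_d} -> R)
    (K delta tau : R) :
  (0 < m)%N -> 1 <= K -> 0 <= delta -> 0 < tau ->
  (forall Y q, 0 <= Q Y q) -> (forall Y, \sum_q Q Y q = 1) ->
  (forall i Y (S : {set {set 'I_d}}),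
    \sum_(q in S) Q Y q <= K * \sum_(q in S) Q (drop_row i Y) q + delta) ->
  (forall i Y (S : {set {set 'I_d}}),
    \sum_(q in S) Q (drop_row i Y) q <= K * \sum_(q in S) Q Y q + delta) ->
  (forall Y, 2 / 3 <= \sum_(q | (75 * #|mistakes Y q| <= d)%N) Q Y q) ->
  d%:R * (1 - 26 / 75 * (20 / 9)) <=
    (K - 1) * (d%:R * (160 * m%:R) / (2 * tau) + m%:R * (tau / 2))
      + 8 * (delta * d%:R * m%:R).
Proof.
move=> m0 K1 delta0 t0 Q0 Q1 dp dp' acc.
pose p0 := wt R m 0 / tot R m.
have p0ge : 9 / 20 <= p0 by exact: const_colpr_ge.
have d0 : 0 <= d%:R :> R by rewrite ler0n.
have mist Y : \sum_q Q Y q * #|mistakes Y q|%:R <= 26 / 75 * d%:R.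
  have mq q : #|mistakes Y q|%:R <= d%:R :> R by rewrite ler_nat card_ord_set.
  pose good q := (75 * #|mistakes Y q| <= d)%N.
  pose b := \sum_(q | ~~ good q) Q Y q.
  have b3 : b <= 1 / 3.
    have := Q1 Y; rewrite (bigID good) /= -/b.
    by have : 2 / 3 <= \sum_(q | good q) Q Y q := acc Y; lra.
  rewrite (bigID good) /=.
  have bad : \sum_(q | ~~ good q) Q Y q * #|mistakes Y q|%:R <= b * d%:R.
    by rewrite mulr_suml; apply: ler_sum => q _; rewrite ler_wpM2l.
  have ok : \sum_(q | good q) Q Y q * #|mistakes Y q|%:R <= d%:R / 75.
    apply: (@le_trans _ _ (\sum_q Q Y q * (d%:R / 75))); last first.
      by rewrite -mulr_suml Q1 mul1r.
    rewrite [leRHS](bigID good) /=; apply: ler_wpDr.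
      by apply: sumr_ge0 => q _; rewrite mulr_ge0 // divr_ge0.
    apply: ler_sum => q; rewrite /good -(ler_nat R) natrM => h.
    by rewrite ler_wpM2l // ler_pdivlMr // mulrC.
  have : b * d%:R <= 1 / 3 * d%:R by rewrite ler_wpM2r.
  by lra.
pose E := \sum_Y colsw R Y * (\sum_q Q Y q * \sum_i trace_score R i Y q).
(* The expected number of all-one columns is [d * p0], so [E] is [d] minus the expected number of
   mistakes divided by [p0]. *)
have lower : d%:R * (1 - 26 / 75 * (20 / 9)) <= E.
  pose nT : R := \sum_(Y : columns m d) colsw R Y * #|[set j | Y j == setT]|%:R.
  have nTE : nT = d%:R * p0.
    rewrite /nT; transitivity (\sum_(j < d) \sum_(Y : columns m d) colsw R Y * (Y j == setT)%:R).
      rewrite exchange_big /=; apply: eq_bigr => Y _.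
      rewrite -mulr_sumr -sum1_card natr_sum big_mkcond /=; congr (_ * _).
      by apply: eq_bigr => j _; rewrite inE; case: eqP.
    rewrite (eq_bigr (fun=> p0)) => [|j _].
      by rewrite sumr_const card_ord mulr_natl.
    rewrite (sum_colsw_marginal (fun x => (x == setT)%:R)) // (bigD1 setT) //= big1.
      by rewrite eqxx mulr1 addr0 colpr_setT.
    by move=> x /negPf ->; rewrite mulr0.
  pose er := \sum_(Y : columns m d) colsw R Y * \sum_q Q Y q * #|mistakes Y q|%:R.
  have erle : er <= 26 / 75 * d%:R.
    apply: (@le_trans _ _ (\sum_(Y : columns m d) colsw R Y * (26 / 75 * d%:R))).
      by apply: ler_sum => Y _; rewrite ler_wpM2l ?colsw_ge0.
    by rewrite -mulr_suml sum_colsw // mul1r.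
  have -> : E = (nT - er) / p0.
    rewrite /E /nT /er -sumrB mulr_suml; apply: eq_bigr => Y _.
    under eq_bigr do rewrite sum_trace_score // mulrA mulrBr.
    by rewrite -mulr_suml sumrB -mulr_suml Q1 mul1r mulrA mulrBr.
  rewrite nTE ler_pdivlMr; last lra.
  suff : 0 <= d%:R * (p0 - 9 / 20) by lra.
  by rewrite mulr_ge0 // subr_ge0.
apply: le_trans lower _.
have -> : E = \sum_i \sum_Y colsw R Y * (\sum_q Q Y q * trace_score R i Y q).
  rewrite exchange_big /=; apply: eq_bigr => Y _; rewrite -mulr_sumr; congr (_ * _).
  by rewrite exchange_big /=; apply: eq_bigr => q _; rewrite mulr_sumr.
pose V (i : 'I_m) : R := \sum_x flux R i x ^+ 2 / colpr R x.
pose e (i : 'I_m) : R := \sum_x `|flux R i x|.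
have step i : \sum_Y colsw R Y * (\sum_q Q Y q * trace_score R i Y q) <=
    (K - 1) * (d%:R * V i / (2 * tau) + tau / 2) + 2 * (delta * d%:R * e i).
  (* A bound on the trace score uniform in [q]; it can be large for some [Y], but only its mean
     [d * e i] enters. *)
  pose A (Y : columns m d) := \sum_j `|score R i (Y j)|.
  have ZA Y q : `|trace_score R i Y q| <= A Y.
    apply: le_trans (ler_norm_sum _ _ _) _; apply: ler_sum => j _.
    by rewrite normrM; case: (_ \in _); rewrite ?normr1 ?normr0 ?mul1r ?mul0r.
  have A0 Y : 0 <= A Y by exact: sumr_ge0.
  have := sum_abs_trace_score_drop_row i m0 t0 Q0 Q1.
  have := sum_trace_score_drop_row i Q m0.
  have : \sum_Y colsw R Y * A Y = d%:R * e i.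
    transitivity (\sum_(j < d) \sum_(Y : columns m d) colsw R Y * `|score R i (Y j)|).
      by rewrite exchange_big /=; apply: eq_bigr => Y _; rewrite mulr_sumr.
    rewrite (eq_bigr (fun=> e i)) => [|j _].
      by rewrite sumr_const card_ord mulr_natl.
    rewrite (sum_colsw_marginal (fun x => `|score R i x|)) //.
    apply: eq_bigr => x _; rewrite -(colpr_score R i x m0) [RHS]normrM.
    by rewrite (ger0_norm (ltW (colpr_gt0 R x m0))).
  set a := \sum_Y _; set z := \sum_Y _; set b := \sum_Y _ => ae z0 ble.
  apply: (@le_trans _ _ (z + (K - 1) * b + 2 * (delta * a))).
    rewrite /z /b /a !mulr_sumr -!big_split /=; apply: ler_sum => Y _.
    have := dp_sum K1 delta0 (Q0 (drop_row i Y)) (dp i Y) (dp' i Y) (ZA Y) (A0 Y).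
    by move=> /(ler_wpM2l (colsw_ge0 R Y m0)); lra.
  rewrite z0 add0r ae.
  have : (K - 1) * b <= (K - 1) * (d%:R * V i / (2 * tau) + tau / 2).
    by rewrite ler_wpM2l //; lra.
  by rewrite mulrA; lra.
apply: le_trans (ler_sum _ (fun i _ => step i)) _.
rewrite big_split /= -!mulr_sumr big_split /= -mulr_suml -mulr_sumr.
rewrite sumr_const card_ord -[_ *+ m]mulr_natl.
have ele : \sum_i e i <= 4 * m%:R := sum_abs_flux_le R m0.
have Vle : \sum_i V i <= 160 * m%:R := sum_sqr_flux_le R m0.
apply: lerD.
  apply: ler_wpM2l; first lra.
  by rewrite lerD2r ler_wpM2r ?ler_wpM2l ?invr_ge0 ?mulr_ge0 ?(ltW t0).
have : delta * d%:R * \sum_i e i <= delta * d%:R * (4 * m%:R).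
  by rewrite ler_wpM2l // mulr_ge0.
by lra.
Qed.

(* Measurability, and finite laws induced by a probability *)
From mathcomp Require Import all_classical all_reals all_analysis.
Import Order.TTheory GRing.Theory Num.Theory.

Lemma measurable_fibers d (T : measurableType d) (F : eqType) (f : T -> F) (s : seq F) :
  (forall q, measurable [set t | f t = q]%classic) ->
  measurable [set t | f t \in s]%classic.
Proof.
move=> mf; elim: s => [|q s IH].
  by rewrite (_ : mkset _ = set0) //; apply/seteqP; split.
rewrite (_ : mkset _ = [set t | f t = q] `|` [set t | f t \in s])%classic; last first.
  apply/seteqP; split => t /=; rewrite inE; first by move=> /orP[/eqP|]; [left|right].
  by move=> [->|->]; rewrite ?eqxx ?orbT.
exact: measurableU.
Qed.

Lemma sum_fibers d (T : measurableType d) (R : realType) (P : probability T R)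
    (F : eqType) (f : T -> F) (s : seq F) :
  (forall q, measurable [set t | f t = q]%classic) -> uniq s ->
  \sum_(q <- s) fine (P [set t | f t = q]%classic) = fine (P [set t | f t \in s]%classic).
Proof.
move=> mf; elim: s => [|q s IH] /=.
  rewrite (_ : mkset _ = set0) ?big_nil ?measure0 //.
  by apply/seteqP; split.
move=> /andP[qs us]; rewrite big_cons IH //.
rewrite (_ : [set t | f t \in q :: s] = [set t | f t = q] `|` [set t | f t \in s])%classic; last first.
  apply/seteqP; split => t /=; rewrite inE; first by move=> /orP[/eqP|]; [left|right].
  by move=> [->|->]; rewrite ?eqxx ?orbT.
rewrite measureU ?fineD ?fin_num_measure //; try exact: measurable_fibers.
by apply/seteqP; split => t //= -[-> qs']; rewrite qs' in qs.
Qed.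

(** Carries a mechanism with outputs in [R^d] over to the finite sums of the fingerprinting
    bound. *)
Lemma sum_fibers_set d (T : measurableType d) (R : realType) (P : probability T R)
    (F : finType) (f : T -> F) (S : pred F) :
  (forall q, measurable [set t | f t = q]%classic) ->
  \sum_(q | S q) fine (P [set t | f t = q]%classic) = fine (P [set t | S (f t)]%classic).
Proof.
move=> mf; rewrite -big_filter sum_fibers ?filter_uniq ?index_enum_uniq //.
congr (fine (P _)); apply/funext => t /=.
by rewrite mem_filter mem_index_enum andbT.
Qed.

Lemma measurable_pattern d (T : measurableType d) (I : finType) (b : I -> T -> bool)
    (q : {set I}) : (forall i, measurable [set t | b i t]%classic) ->
  measurable [set t | finset (b^~ t) = q]%classic.
Proof.
move=> mb.
rewrite (_ : mkset _ = \bigcap_(i in setT) [set t | b i t = (i \in q)])%classic; last first.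
  apply/seteqP; split => t /=; first by move=> <- i _ /=; rewrite inE.
  by move=> h; apply/setP => i; rewrite inE; exact: h.
apply: fin_bigcap_measurable => [|i _]; first exact: finite_finset.
case: (i \in q); first exact: mb.
rewrite (_ : mkset _ = ~` [set t | b i t])%classic; first exact: measurableC.
by apply/seteqP; split => t /=; case: (b i t).
Qed.

Lemma measurable_tnth_itv (R : realType) d (j : 'I_d) (i : interval R) :
  measurable [set a : d.-tuple R | tnth a j \in i]%classic.
Proof.
have := @measurable_tnth _ R d j measurableT [set` i]%classic (measurable_itv i).
by rewrite setTI.
Qed.

(** Accuracy depends only on which columns are answered within their interval, a pattern with
    finitely many values. *)
Lemma measurable_accurate (R : realType) n d (eta alpha beta : R) (Y : dataset n d) :
  measurable [set a | accurate_out eta alpha beta Y a]%classic.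
Proof.
pose b (j : 'I_d) (a : d.-tuple R) :=
  (eta^-1 * colmean R Y j - alpha <= tnth a j) && (tnth a j <= eta * colmean R Y j + alpha).
have mb j : measurable [set a | b j a]%classic.
  have := measurable_tnth_itv j `[eta^-1 * colmean R Y j - alpha, eta * colmean R Y j + alpha].
  by under eq_set do rewrite in_itv.
pose G := enum [pred q : {set 'I_d} | (1 - beta) * d%:R <= #|q|%:R].
rewrite (_ : mkset _ = [set a | finset (b^~ a) \in G])%classic; last first.
  apply/funext => a /=; rewrite /G mem_enum inE /accurate_out.
  congr (is_true (_ <= _%:R)).
  apply: eq_card => j; rewrite [RHS]inE.
  by apply/idP/idP => [/set_mem|h]; last exact: mem_set.
by apply: measurable_fibers => q; exact: measurable_pattern.
Qed.

(** * Group privacy and the passage from a mechanism to random sets of columns *)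

(** The rows in [B] are replaced one at a time. Each new [delta] is bounded by the full exponential
    factor times [delta], which avoids a geometric sum. *)
Lemma group_privacy (R : realType) n d (M : mechanism R n d) (eps delta : R)
    (B : {set 'I_n}) (Y Y' : dataset n d) (S : set (d.-tuple R)) :
  0 <= eps -> 0 <= delta -> is_DP M eps delta -> measurable S ->
  (forall i, i \notin B -> forall j, Y i j = Y' i j) ->
  fine (M Y S) <= expR (#|B|%:R * eps) * (fine (M Y' S) + #|B|%:R * delta).
Proof.
move=> eps0 delta0 dp mS.
have dpr Y1 Y2 : neighbors Y1 Y2 -> fine (M Y1 S) <= expR eps * fine (M Y2 S) + delta.
  move=> /dp/(_ S mS).
  by rewrite -[M Y1 S]fineK ?fin_num_measure // -[M Y2 S]fineK ?fin_num_measure.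
elim: {B}_.+1 {-2}B Y (ltnSn #|B|) => // k IH B Y Bk agree.
have [B0|[i iB]] := set_0Vmem B.
  rewrite B0 cards0 mul0r expR0 mul1r mul0r addr0.
  by rewrite (_ : Y = Y') //; apply/matrixP => i j; apply: agree; rewrite B0 inE.
pose Y2 : dataset n d := \matrix_(i', j) (if i' == i then Y' i' j else Y i' j).
have nb : neighbors Y Y2 by exists i => i' /negPf ii j; rewrite mxE ii.
have := IH (B :\ i) Y2; rewrite (cardsD1 i B) iB /= add1n in Bk *.
move=> /(_ Bk) h; apply: le_trans (dpr _ _ nb) _.
have {}h : fine (M Y2 S) <= expR (#|B :\ i|%:R * eps) * (fine (M Y' S) + #|B :\ i|%:R * delta).
  apply: h => i' i'B j; rewrite mxE; case: eqP => // /eqP ii; apply: agree.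
  by move: i'B; rewrite !inE ii.
move: #|B :\ i| h => c h.
rewrite -natr1 mulrDl mul1r expRD [expR _ * expR eps]mulrC -mulrA.
have e1 : 1 <= expR eps by rewrite -expR0 ler_expR.
have e2 : 1 <= expR (c%:R * eps) by rewrite -expR0 ler_expR mulr_ge0.
have := ler_wpM2l (ltW (expR_gt0 eps)) h.
have : delta <= expR eps * expR (c%:R * eps) * delta.
  by rewrite ler_peMl // mulr_ege1.
by lra.
Qed.

Definition replicate_rows n m d (phi : 'I_n -> 'I_m) (Y : columns m d) : dataset n d :=
  \matrix_(i, j) (phi i \in Y j).

Definition above (R : realType) d (alpha : R) (a : d.-tuple R) : {set 'I_d} :=
  [set j | alpha < tnth a j].

Definition above_pr (R : realType) n m d (M : mechanism R n d) (phi : 'I_n -> 'I_m)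
    (alpha : R) (Y : columns m d) (q : {set 'I_d}) : R :=
  fine (M (replicate_rows phi Y) [set a | above alpha a = q]%classic).

Lemma measurable_above (R : realType) d (alpha : R) (q : {set 'I_d}) :
  measurable [set a : d.-tuple R | above alpha a = q]%classic.
Proof.
apply: (measurable_pattern (b := fun j (a : d.-tuple R) => alpha < tnth a j)) => j.
have := measurable_tnth_itv j `]alpha, +oo[.
by under eq_set do rewrite in_itv /= andbT.
Qed.

(* As [eta * alpha < 1/2], the intervals allowed for the means 0 and 1 are
   separated by the threshold [alpha]. *)
Lemma mistakes_accurate (R : realType) n m d (phi : 'I_n -> 'I_m) (eta alpha : R)
    (Y : columns m d) (a : d.-tuple R) :
  (0 < n)%N -> 1 <= eta -> eta * alpha < 1 / 2 ->
  accurate_out eta alpha (1 / 75) (replicate_rows phi Y) a ->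
  (75 * #|mistakes Y (above alpha a)| <= d)%N.
Proof.
move=> n0 eta1 etaalpha; rewrite /accurate_out; set G := mkset _ => acc.
have eta0 : 0 < eta by lra.
have GM : (#|G| + #|mistakes Y (above alpha a)| <= d)%N.
  rewrite -[d in leqRHS]card_ord -(cardC (mem G)) leq_add2l subset_leq_card //.
  apply/fintype.subsetP => j; rewrite finset.in_set => mj; rewrite inE.
  apply/negP => /set_mem; rewrite /G /= => /andP[lo hi]; move: mj.
  case/orP => /andP[/eqP Yj]; rewrite inE.
  - rewrite -leNgt => ja; move: lo; rewrite /colmean (eq_bigr (fun=> 1)) => [|i _].
      rewrite sumr_const card_ord divff ?pnatr_eq0 -?lt0n // mulr1.
      (* An accurate answer at most [alpha] for mean 1 forces [1 / eta - alpha <= alpha], that is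
         [1 <= 2 * eta * alpha]. *)
      have := ler_wpM2l (ltW eta0) (_ : eta^-1 <= 2 * alpha).
      by rewrite divff ?gt_eqF // => /(_ _); lra.
    by rewrite mxE Yj inE.
  - move=> ja; move: hi; rewrite /colmean big1 => [|i _].
      by rewrite mul0r mulr0 add0r leNgt ja.
    by rewrite mxE Yj inE.
have : 74 * d%:R <= 75 * #|G|%:R :> R by lra.
by rewrite -!natrM ler_nat; lia.
Qed.

(** Changing one random row changes at most [k] rows of the data set, so group privacy gives the
    fingerprinting bound with [K = e^2] and [delta] multiplied by [k * e^2]. *)
Lemma replicate_rows_bound (R : realType) n m d k (M : mechanism R n d) (phi : 'I_n -> 'I_m)
    (eps delta eta alpha tau : R) :
  (0 < n)%N -> (0 < m)%N -> 0 <= eps -> 0 <= delta -> 0 < tau ->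
  (forall r, #|[set i | phi i == r]| <= k)%N -> k%:R * eps <= 2 ->
  1 <= eta -> eta * alpha < 1 / 2 ->
  is_DP M eps delta -> accurate_mech M eta alpha (1 / 75) ->
  d%:R * (1 - 26 / 75 * (20 / 9)) <=
    (expR 2 - 1) * (d%:R * (160 * m%:R) / (2 * tau) + m%:R * (tau / 2))
      + 8 * ((expR 2 * (k%:R * delta)) * d%:R * m%:R).
Proof.
move=> n0 m0 eps0 delta0 tau0 fib keps eta1 etaalpha dp acc.
have sumE Y (S : pred {set 'I_d}) : \sum_(q | S q) above_pr M phi alpha Y q =
    fine (M (replicate_rows phi Y) [set a | S (above alpha a)]%classic).
  by apply: sum_fibers_set => q; exact: measurable_above.
have mS (S : pred {set 'I_d}) : measurable [set a : d.-tuple R | S (above alpha a)]%classic.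
  rewrite (_ : mkset _ = [set a | above alpha a \in enum S])%classic.
    by apply: measurable_fibers => q; exact: measurable_above.
  by apply/funext => a /=; rewrite mem_enum.
have grp i (Y1 Y2 : columns m d) (S : set (d.-tuple R)) : measurable S -> 
    (forall j r, r != i -> (r \in Y1 j) = (r \in Y2 j)) ->
    fine (M (replicate_rows phi Y1) S) <=
    expR 2 * fine (M (replicate_rows phi Y2) S) + expR 2 * (k%:R * delta).
  move=> mS' h.
  have := @group_privacy R n d M eps delta [set l | phi l == i]
    (replicate_rows phi Y1) (replicate_rows phi Y2) S eps0 delta0 dp mS'.
  move=> /(_ _)/le_trans; apply.
    by move=> l; rewrite inE => li j; rewrite !mxE h.
  have F0 : 0 <= fine (M (replicate_rows phi Y2) S) by rewrite fine_ge0.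
  rewrite -mulrDr; apply: ler_pM; rewrite ?expR_ge0 ?addr_ge0 ?mulr_ge0 //.
    by rewrite ler_expR; apply: le_trans keps; rewrite ler_wpM2r // ler_nat.
  by rewrite lerD2l ler_wpM2r // ler_nat.
apply: (@fingerprinting_bound R m d (above_pr M phi alpha)) => //.
- by rewrite -expR0 ler_expR.
- by rewrite !mulr_ge0 ?expR_ge0.
- by move=> Y q; rewrite fine_ge0.
- move=> Y; rewrite (sumE Y xpredT) (_ : mkset _ = setT) ?probability_setT //.
  by apply/seteqP; split.
- move=> i Y S; rewrite !(sumE _ (mem S)); apply: (grp i) => // j r ri.
  by rewrite ffunE !inE ri.
- move=> i Y S; rewrite !(sumE _ (mem S)); apply: (grp i) => // j r ri.
  by rewrite ffunE !inE ri.
- move=> Y; rewrite (sumE Y (fun q => 75 * #|mistakes Y q| <= d)%N).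
  have mY := mS (fun q => 75 * #|mistakes Y q| <= d)%N.
  rewrite -lee_fin fineK; last exact: fin_num_measure.
  apply: le_trans (acc (replicate_rows phi Y)) _; apply: le_measure.
  + by rewrite inE; exact: measurable_accurate.
  + by rewrite inE; exact: mY.
  + by move=> a; exact: mistakes_accurate.
Qed.

(** * Choice of the parameters and conclusion *)

(** On a residue class mod [m] the quotient [i %/ m] determines [i]. *)
Lemma card_modn_fiber_le n m (m0 : (0 < m)%N) (r : 'I_m) :
  (#|[set i : 'I_n | Ordinal (ltn_pmod i m0) == r]| <= (n %/ m).+1)%N.
Proof.
have lt (i : 'I_n) : (i %/ m < (n %/ m).+1)%N by rewrite ltnS leq_div2r // ltnW.
rewrite -[leqRHS]card_ord.
apply: (leq_card_in (fun i => Ordinal (lt i))) => i j.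
rewrite !inE -!val_eqE /= => /eqP ir /eqP jr [ij].
by apply/val_inj; rewrite /= (divn_eq i m) (divn_eq j m) ij ir jr.
Qed.

Lemma accurate_mech0 (R : realType) n d (M : mechanism R n d) (eta alpha beta : R) :
  0 <= beta -> accurate_mech M eta alpha 0 -> accurate_mech M eta alpha beta.
Proof.
move=> beta0 acc Y; apply: le_trans (acc Y) _; apply: le_measure;
  rewrite ?inE; try exact: measurable_accurate.
move=> a; rewrite /= /accurate_out; apply: le_trans; rewrite ler_wpM2r //; lra.
Qed.

(** Allows [delta] to be replaced by [c / n], which is nonnegative. *)
Lemma is_DP_le (R : realType) n d (M : mechanism R n d) (eps delta delta' : R) :
  delta <= delta' -> is_DP M eps delta -> is_DP M eps delta'.
Proof.
move=> dd dp Y Y' nb S mS; apply: le_trans (dp Y Y' nb S mS) _.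
by rewrite leeD2l // lee_fin.
Qed.

Theorem mainTheorem11 (R : realType) :
  exists c : R, 0 < c /\
  exists N : nat -> R -> R,
    (* N(d, eps) = ~Theta(sqrt d / eps), polylog factors in d *)
    (exists (k : nat) (C : R) (d0 : nat), 0 < C /\
       forall d : nat, (d0 <= d)%N -> forall eps : R, 0 < eps <= 1 ->
         Num.sqrt (d%:R) / (C * eps * (ln (d%:R)) ^+ k) <= N d eps /\
         N d eps <= C * Num.sqrt (d%:R) * (ln (d%:R)) ^+ k / eps) /\
    forall (d : nat) (eps : R), 0 < eps <= 1 ->
    forall n : nat, (0 < n)%N -> n%:R <= N d eps ->
    forall eta alpha : R, 1 <= eta -> 0 <= alpha <= 1 -> eta * alpha < 1 / 2 ->
    forall delta : R, delta <= c / n%:R ->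
    forall M : mechanism R n d,
      is_DP M eps delta ->
      ~ accurate_mech M eta alpha (1 / 75) /\ ~ accurate_mech M eta alpha 0.
Proof.
have E1 : 1 <= expR 2 :> R by rewrite -expR0 ler_expR.
(* [C1] and [c] are chosen so that the two error terms are at most [161/2000 * d] and [2/25 * d]. *)
have [C1 C1E] : exists C1 : R, C1 = 1000 * expR 2 by exists (1000 * expR 2).
have C1ge : 1 <= C1 by lra.
have C10 : 0 < C1 by lra.
pose c : R := 1 / (200 * expR 2).
have c0 : 0 < c by rewrite divr_gt0 // mulr_gt0 // expR_gt0.
exists c; split => //.
(* For small [d] the value 0 excludes every positive [n]. *)
exists (fun d eps => if C1 <= Num.sqrt d%:R then Num.sqrt d%:R / (2 * C1 * eps) else 0).
split.
  exists 0%N, (2 * C1), (Num.bound (C1 ^+ 2)); split; first lra.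
  move=> d dge eps /andP[eps0 eps1]; rewrite expr0 !mulr1.
  have -> : C1 <= Num.sqrt d%:R.
    rewrite -(@ler_pXn2r _ 2) ?nnegrE ?sqrtr_ge0 //; last lra.
    rewrite sqr_sqrtr //; apply: le_trans (ltW (archi_boundP (sqr_ge0 C1))) _.
    by rewrite ler_nat.
  split=> //; have s0 : 0 <= Num.sqrt (d%:R : R) by rewrite sqrtr_ge0.
  rewrite ler_pdivrMr; last by rewrite !mulr_gt0.
  have -> : 2 * C1 * Num.sqrt d%:R / eps * (2 * C1 * eps) =
    (2 * C1) ^+ 2 * Num.sqrt d%:R by field; lra.
  by rewrite ler_peMl // expr_ge1 //; lra.
move=> d eps /andP[eps0 eps1] n n0; case: ifP => [Cs nN|_]; last first.
  by rewrite lern0 => /eqP n00; rewrite n00 in n0.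
move=> eta alpha eta1 _ etaalpha delta /is_DP_le dple M /dple{dple}dp.
suff notacc : ~ accurate_mech M eta alpha (1 / 75).
  by split=> // acc; apply: notacc; apply: accurate_mech0 acc; lra.
move=> acc; move: Cs nN; set s := Num.sqrt _ => Cs nN.
have sd : s ^+ 2 = d%:R by rewrite sqr_sqrtr.
have s0 : 0 < s by lra.
have nr : 0 < n%:R :> R by rewrite ltr0n.
pose m0 := Num.truncn (s / C1).
have /truncn_itv/andP[m0le m0gt] : 0 <= s / C1 by rewrite divr_ge0 // ltW.
rewrite -/m0 in m0le m0gt.
have s1 : 1 <= s / C1 by rewrite ler_pdivlMr // mul1r.
have m0gt0 : (0 < m0)%N by rewrite -ltnS -(ltr_nat R); exact: le_lt_trans m0gt.
have m01 : 1 <= m0%:R :> R by rewrite ler1n.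
rewrite -natr1 in m0gt.
(* There are about [sqrt d / C1] random rows, but never more than [n]; hence [m <= n] and
   [k * m <= n + m <= 2 * n]. *)
pose m := minn n m0.
have mgt0 : (0 < m)%N by rewrite leq_min n0.
pose k := (n %/ m).+1.
have km : k%:R * m%:R <= 2 * n%:R :> R.
  rewrite -!natrM ler_nat /k mulSn addnC mul2n -addnn leq_add ?leq_trunc_div //.
  exact: geq_minl.
have mle : m%:R * C1 <= s.
  by rewrite -ler_pdivlMr //; apply: le_trans m0le; rewrite ler_nat geq_minr.
have keps : k%:R * eps <= 2.
  case: (leqP n m0) => nm.
    have -> : k = 2%N by rewrite /k /m (minn_idPl nm) divnn n0.
    by lra.
  have mE : m = m0 by rewrite /m (minn_idPr (ltnW nm)).
  rewrite mE in km; have m0p : 0 < m0%:R :> R by lra.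
  rewrite -(ler_pM2r m0p).
  move: nN; rewrite ler_pdivlMr; last by rewrite !mulr_gt0.
  move=> nN.
  (* Hence [k * m0 * eps <= 2 * n * eps <= s / C1 < m0 + 1 <= 2 * m0]. *)
  have neps : n%:R * (2 * eps) <= s / C1 by rewrite ler_pdivlMr //; lra.
  have := ler_wpM2r (ltW eps0) km; lra.
(* Rows are repeated cyclically, and the AM-GM parameter is [sqrt d], the order of the standard
   deviation of [Z_i]. *)
have := @replicate_rows_bound R n m d k M (fun i => Ordinal (ltn_pmod i mgt0))
  eps (c / n%:R) eta alpha s n0 mgt0 (ltW eps0) (divr_ge0 (ltW c0) (ltW nr)) s0
  (card_modn_fiber_le n mgt0) keps eta1 etaalpha dp acc.
apply/negP; rewrite -ltNge -sd.
have -> : s ^+ 2 * (160 * m%:R) / (2 * s) + m%:R * (s / 2) = 161 / 2 * (m%:R * s).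
  by field; lra.
have -> : 8 * (expR 2 * (k%:R * (c / n%:R)) * s ^+ 2 * m%:R) =
    (k%:R * m%:R) * (s ^+ 2 / (25 * n%:R)).
  by rewrite /c; field; rewrite !gt_eqF ?expR_gt0.
have s20 : 0 < s ^+ 2 by rewrite exprn_gt0.
have h1 : (k%:R * m%:R) * (s ^+ 2 / (25 * n%:R)) <= 2 / 25 * s ^+ 2.
  have -> : 2 / 25 * s ^+ 2 = (2 * n%:R) * (s ^+ 2 / (25 * n%:R)) by field; lra.
  by rewrite ler_wpM2r // divr_ge0 ?ltW // mulr_gt0.
have h2 : (expR 2 - 1) * (161 / 2 * (m%:R * s)) <= 161 / 2000 * s ^+ 2.
  have := ler_wpM2r (ltW s0) mle; rewrite -expr2 C1E.
  have : 0 <= m%:R * s by rewrite mulr_ge0 // ltW.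
  by lra.
(* The left side is [31/135 * s^2], more than [0.22 * s^2], while the errors add up to at most
   [0.1605 * s^2]. *)
by lra.
Qed.
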